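(* Let $q=2$ and let $k$ be a positive integer. Given any two distinct words $u,v\in\mathcal C(k)$, there exist an integer $N\le 6$ and a sequence of words $u=u^{(1)},u^{(2)},\dots,u^{(N-1)},u^{(N)}=v$ in $\mathcal C(k)$ such that for any $1\le i<N$, either $u^{(i+1)}$ is obtained from $u^{(i)}$ by flipping all bits or $$\mathrm{overlap}(u^{(i)},u^{(i+1)})=\mathrm{overlap}(u^{(i+1)},u^{(i)})=\emptyset.$$ Consequently, there is a chain of swap conjugacies from $X_{\{u\}}$ to $X_{\{v\}}$, and the length of the chain is upper bounded by $6$.
   Context: For words $u,v$ of length $k$ over $[q]=\{0,\dots,q-1\}$, $\mathrm{overlap}(u,v)=\{i\in\{1,\dots,k\}: v_1\cdots v_i=u_{k-i+1}\cdots u_k\}$. $$\mathcal C(k)=\{w\in\{0,1\}^k\setminus\{10^{k-1},01^{k-1},1^{k-1}0,0^{k-1}1\}: \mathrm{overlap}(w,w)=\{k\}\}.$$ $X_{\{w\}}\subset[q]^{\mathbb Z}$ is the set of bi-infinite sequences not containing $w$. A conjugacy between shift spaces is a bijective sliding block code. A swap conjugacy between $X_{\{u\}}$ and $X_{\{v\}}$ is a conjugacy of one of two types: the one given by replacing every appearance of $v$ by $u$ and every appearance of $u$ by $v$ (simultaneously) in a sequence, or the one given by applying letterwise a permutation of the alphabet taking $u$ to $v$. A chain of swap conjugacies from $X_{\{u\}}$ to $X_{\{v\}}$ is a sequence $X_{\{u^{(1)}\}},\dots,X_{\{u^{(N)}\}}$ with $u^{(1)}=u$, $u^{(N)}=v$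 and a swap conjugacy between each consecutive pair. *)

(* Defs.v *)
From mathcomp Require Import all_boot all_order all_algebra all_fingroup.
From mathcomp Require Import boolp classical_sets functions.

Set Implicit Arguments.
Unset Strict Implicit.
Unset Printing Implicit Defensive.

Section Words.
Variables (A : finType) (k : nat).
Implicit Types (u v w : k.-tuple A).

(* The index [i] ranges over the naturals [<= k]; [0] is filtered out since
   the empty prefix does not count as an overlap. *)
Definition overlap u v : {set 'I_k.+1} :=
  [set i : 'I_k.+1 | (0 < i) && (take i v == drop (k - i) u)]%SET.

Definition occurs_at w (x : int -> A) (i : int) : Prop :=
  forall j : 'I_k, x (i + j%:Z)%R = tnth w j.

Definition avoiding w : set (int -> A) :=
  [set x | forall i, ~ occurs_at w x i]%classic.

(* As a relation this makes sense for all [u], [v] and [x]: when occurrences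
   overlap and the replacements disagree, there is no such [y].  In every case
   there is at most one. *)
Definition swapped u v (x y : int -> A) : Prop :=
  [/\ forall i, occurs_at u x i -> occurs_at v y i,
      forall i, occurs_at v x i -> occurs_at u y i
    & forall n : int,
        (forall i : int, (i <= n)%R -> (n < i + k%:Z)%R ->
           ~ occurs_at u x i /\ ~ occurs_at v x i) ->
        y n = x n].

End Words.

(* The window is [x_{i-m} ... x_{i+n}]; only the values of [phi] on [X]
   matter. *)
Definition sliding_block_code (A B : finType) (X : set (int -> A))
    (phi : (int -> A) -> int -> B) : Prop :=
  exists (m n : nat) (Phi : (m + n).+1.-tuple A -> B),
    forall x, X x -> forall i : int,
      phi x i = Phi [tuple x (i - m%:Z + j%:Z)%R | j < (m + n).+1].

Definition conjugacy (A B : finType) (X : set (int -> A)) (Y : set (int -> B))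
    (phi : (int -> A) -> int -> B) : Prop :=
  sliding_block_code X phi /\ set_bij X Y phi.

Definition swap_conjugacy (A : finType) (k : nat) (u v : k.-tuple A)
    (phi : (int -> A) -> int -> A) : Prop :=
  conjugacy (avoiding u) (avoiding v) phi /\
  ((forall x, avoiding u x -> swapped u v x (phi x)) \/
   (exists2 s : {perm A}, map_tuple s u = v &
      forall x, avoiding u x -> phi x = s \o x)).

(* The chain is [w 1, ..., w N]; other values of [w] are irrelevant. *)
Definition swap_chain (A : finType) (k : nat) (u v : k.-tuple A)
    (N : nat) (w : nat -> k.-tuple A) : Prop :=
  [/\ 1 <= N, w 1 = u, w N = v
    & forall i, 1 <= i < N -> exists phi, swap_conjugacy (w i) (w i.+1) phi].

(* The bits 0 and 1 are [false] and [true]. *)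
Definition flip (k : nat) (w : k.-tuple bool) : k.-tuple bool :=
  map_tuple negb w.

Definition C (k : nat) : {set k.-tuple bool} :=
  [set w : k.-tuple bool |
    (tval w \notin [:: true :: nseq k.-1 false;
                       false :: nseq k.-1 true;
                       rcons (nseq k.-1 true) false;
                       rcons (nseq k.-1 false) true])
    && (overlap w w == [set ord_max])]%SET.

(* Main.v *)
Require Import Defs.
From mathcomp Require Import all_boot all_order all_algebra all_fingroup.
From mathcomp Require Import boolp classical_sets functions.
From mathcomp Require Import zify.

(** Words of [C k] that start with 1 end with 0, and a word of the other kind
    is the flip of one of these; since flipping preserves every overlap, the
    task reduces to joining two words starting with 1 by at most four
    overlap-free steps, plus at most one flip.

    The intermediate words are the blocks [1^a 0^(k-a)] with [2 <= a <= k-2]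
    and the hub [1 0 1 0^(k-3)].  A suffix of a word [w] ending in 0 is a prefix
    of [1^a 0^(k-a)] only if it is [1^a 0^s], so the last run of ones of [w] has
    length at least [a] ([overlap_block_suffix]); likewise a prefix of [w] is a
    suffix of the block only if the first run of zeros of [w] has length at
    least [k-a] ([overlap_block_prefix]).  In the hub both runs have length 1,
    so the hub overlaps no block.  A word that is not a block contains 01 at
    some positions [t], [t+1]; if [d] is its first 0 and [e] its last 1, then
    the last run of ones has length at most [e-t] and the first run of zeros
    at most [t+1-d], and [a := e-t+1] works because [d >= 1] and [e <= k-2]
    ([block_or_edge_block]).  Every word starting with 1 is therefore at
    distance at most 2 from the hub.  This needs [k >= 5]; for [k <= 4] the
    only word starting with 1 is 1100.

    For the conjugacies, suppose that no two of [u], [v] overlap, except each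
    with itself along its full length.  Then occurrences of [u] and [v] in a
    sequence are pairwise disjoint, so swapping them simultaneously makes
    sense.  An occurrence of [u] or [v] in the image cannot meet a swapped
    block partially, nor avoid all of them (it would then have been swapped),
    so it is one of the swapped blocks ([swapped_occurs]).  Hence the swap
    relation is symmetric, the swap is an involution, and it exchanges the
    sequences avoiding [u] with those avoiding [v]. *)

Set Implicit Arguments.
Unset Strict Implicit.
Unset Printing Implicit Defensive.

Import GRing.Theory.

(** * Overlaps and positions of occurrences *)

Section Overlap.
Variables (A : finType) (k : nat).
Implicit Types (u v w a b : k.-tuple A) (x y : int -> A).

Lemma overlapP (x0 : A) u v (i : 'I_k.+1) :
  reflect (0 < i /\ forall j, j < i -> nth x0 v j = nth x0 u (k - i + j))
          (i \in overlap u v).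
Proof.
have le_ik : i <= k by rewrite -ltnS.
have sz_take : size (take i v) = i by rewrite size_takel ?size_tuple.
rewrite inE; apply: (iffP andP) => -[i_gt0].
  move=> /eqP eq_uv; split=> // j lt_ji.
  by rewrite -nth_drop -eq_uv nth_take.
move=> eq_uv; split=> //; apply/eqP/(@eq_from_nth _ x0).
  by rewrite sz_take size_drop size_tuple subKn.
by rewrite sz_take => j lt_ji; rewrite nth_take // nth_drop eq_uv.
Qed.

Lemma overlap0P (x0 : A) u v :
  (forall i, 0 < i <= k ->
     ~ (forall j, j < i -> nth x0 v j = nth x0 u (k - i + j))) ->
  overlap u v = finset.set0.
Proof.
move=> no_ov; apply/setP => i; rewrite finset.in_set0; apply/(overlapP x0).
by case=> i_gt0; apply: no_ov; rewrite i_gt0 -ltnS ltn_ord.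
Qed.

Lemma occurs_nth (x0 : A) w x (i : int) m :
  occurs_at w x i -> m < k -> x (i + m%:Z)%R = nth x0 w m.
Proof. by move=> w_i lt_mk; rewrite (w_i (Ordinal lt_mk)) (tnth_nth x0). Qed.

Lemma occurs_overlap u v x (i : int) d :
    occurs_at u x i -> occurs_at v x (i + d%:Z)%R -> d < k ->
  inord (k - d) \in overlap u v.
Proof.
move=> u_i v_j lt_dk; apply/(overlapP (x 0%R)); rewrite inordK; last by lia.
split=> [|m lt_m]; first by rewrite subn_gt0.
rewrite -(occurs_nth _ v_j); last by lia.
rewrite -(occurs_nth _ u_i); last by lia.
by congr x; lia.
Qed.

(** The pairs with [a = b] are included, so [u] and [v] are also unbordered. *)
Definition non_overlapping u v :=
  forall a b, a \in [:: u; v] -> b \in [:: u; v] ->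
  forall i, i \in overlap a b -> a = b /\ i = ord_max.

Lemma non_overlappingC u v : non_overlapping u v -> non_overlapping v u.
Proof.
have mem_vu c : (c \in [:: v; u]) = (c \in [:: u; v]) by rewrite !inE orbC.
by move=> no_uv a b; rewrite !mem_vu; apply: no_uv.
Qed.

Definition covers (n i : int) : Prop := (i <= n)%R /\ (n < i + k%:Z)%R.

(** Two occurrences covering a common position at distance [d] give an overlap
    of length [k - d]; only the full overlap of a word with itself remains. *)
Lemma occurs_disjoint u v a b x i j n :
    non_overlapping u v -> a \in [:: u; v] -> b \in [:: u; v] ->
    occurs_at a x i -> occurs_at b x j -> covers n i -> covers n j ->
  a = b /\ i = j.
Proof.
wlog le_ij : a b i j / (i <= j)%R.
  move=> IH no_uv aP bP a_i b_j n_i n_j.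
  have [le_ij|le_ji] : (i <= j)%R \/ (j <= i)%R by lia.
    exact: IH.
  by have [-> ->] := IH b a j i le_ji no_uv bP aP b_j a_i n_j n_i.
move=> no_uv aP bP a_i b_j [le_in lt_ni] [le_jn lt_nj].
have [d def_j] : exists d : nat, j = (i + d%:Z)%R by exists `|j - i|%N; lia.
have lt_dk : d < k by lia.
rewrite def_j in b_j *.
have /(no_uv _ _ aP bP)[-> /(congr1 val)] := occurs_overlap a_i b_j lt_dk.
by rewrite /= inordK ?ltnS ?leq_subr // => ?; split=> //; lia.
Qed.

End Overlap.

(** * Swap conjugacies *)

Section Swap.
Variables (A : finType) (k : nat).
Implicit Types (u v w a b : k.-tuple A) (x y : int -> A).
Hypothesis k_gt0 : 0 < k.

Lemma swappedC u v x y : swapped u v x y -> swapped v u x y.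
Proof.
case=> u_v v_u fix_xy; split=> // n no_n.
by apply: fix_xy => i *; have [] := no_n i.
Qed.

Lemma occurs_cover_cases u v x n :
  [\/ exists2 i, covers k n i & occurs_at u x i,
      exists2 i, covers k n i & occurs_at v x i
    | forall i : int, (i <= n)%R -> (n < i + k%:Z)%R ->
        ~ occurs_at u x i /\ ~ occurs_at v x i].
Proof.
case: (pselect (exists2 i, covers k n i & occurs_at u x i)) => [?|no_u].
  by constructor 1.
case: (pselect (exists2 i, covers k n i & occurs_at v x i)) => [?|no_v].
  by constructor 2.
by constructor 3 => i *; split=> occ_i; [apply: no_u | apply: no_v]; exists i.
Qed.

(** Swapping creates no occurrence: an occurrence of [v] in [y] that shares a
    position with a swapped block is that block by disjointness in [y]; one that
    shares none lies where [x] and [y] agree, so it occurs in [x] and would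
    itself be a swapped block. *)
Lemma swapped_occurs u v x y i :
    non_overlapping u v -> swapped u v x y -> occurs_at v y i ->
  occurs_at u x i.
Proof.
move=> no_uv [u_v v_u fix_xy] v_i.
have uP : u \in [:: u; v] by rewrite !inE eqxx.
have vP : v \in [:: u; v] by rewrite !inE eqxx orbT.
have [[n n_i [j n_j occ_j]]|uncov] := pselect (exists2 n, covers k n i &
  exists2 j, covers k n j & occurs_at u x j \/ occurs_at v x j).
  case: occ_j => [u_j | v_j].
    by have [_ ->] := occurs_disjoint no_uv vP vP v_i (u_v _ u_j) n_i n_j.
  have [eq_vu ->] := occurs_disjoint no_uv vP uP v_i (v_u _ v_j) n_i n_j.
  by rewrite -eq_vu.
have v_xi : occurs_at v x i.
  move=> j; rewrite -v_i; apply/esym/fix_xy => m le_m lt_m.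
  have := ltn_ord j => lt_jk.
  split=> occ_m; apply: uncov; exists (i + j%:Z)%R.
  - by rewrite /covers; lia.
  - by exists m; [| left].
  - by rewrite /covers; lia.
  - by exists m; [| right].
have i_i : covers k i i by rewrite /covers; lia.
by case: uncov; exists i => //; exists i => //; right.
Qed.

Lemma swapped_sym u v x y :
  non_overlapping u v -> swapped u v x y -> swapped u v y x.
Proof.
move=> no_uv sw_xy; have [u_v v_u fix_xy] := sw_xy; split=> [i|i|n no_n].
- exact: swapped_occurs (non_overlappingC no_uv) (swappedC sw_xy).
- exact: swapped_occurs no_uv sw_xy.
rewrite fix_xy // => i le_in lt_ni; have [no_u no_v] := no_n i le_in lt_ni.
by split=> [/u_v | /v_u].
Qed.

Lemma swapped_inj u v x y y' :
  swapped u v x y -> swapped u v x y' -> y = y'.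
Proof.
have occ_eq w z z' i n : covers k n i -> occurs_at w z i -> occurs_at w z' i ->
    z n = z' n.
  move=> [le_in lt_ni] w_z w_z'.
  have [d def_n] : exists d : nat, n = (i + d%:Z)%R by exists `|n - i|%N; lia.
  have lt_dk : d < k by lia.
  by rewrite def_n (w_z (Ordinal lt_dk)) (w_z' (Ordinal lt_dk)).
move=> [u_v v_u fix_y] [u_v' v_u' fix_y']; apply/funext => n.
have [[i n_i occ_i]|[i n_i occ_i]|uncov] := occurs_cover_cases u v x n.
- exact: occ_eq n_i (u_v _ occ_i) (u_v' _ occ_i).
- exact: occ_eq n_i (v_u _ occ_i) (v_u' _ occ_i).
- by rewrite fix_y // fix_y'.
Qed.

(** The swap is computed on a window [g] of radius [k-1] centred at index
    [k-1]: [occ_offset w g] is the offset of the centre within an occurrence of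
    [w] covering it.  Windows are functions on [nat], so that the same rule
    applies to a sequence and to the tuple read by a sliding block code. *)
Definition occ_offset w (g : nat -> A) : option 'I_k :=
  [pick j : 'I_k | [forall l : 'I_k, g (k.-1 - j + l) == tnth w l]].

Definition swap_rule u v (g : nat -> A) : A :=
  if occ_offset u g is Some j then tnth v j
  else if occ_offset v g is Some j then tnth u j else g k.-1.

Definition swap_map u v x : int -> A :=
  fun n => swap_rule u v (fun p => x (n - k.-1%:Z + p%:Z)%R).

Lemma occ_offset_ext w g h :
  (forall p, p < (k.-1 + k.-1).+1 -> g p = h p) ->
  occ_offset w g = occ_offset w h.
Proof.
move=> eq_gh; apply: eq_pick => j; apply: eq_forallb => l.
by rewrite eq_gh //; have := ltn_ord j; have := ltn_ord l; lia.
Qed.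

Lemma occ_offset_occurs w x n (j : 'I_k) :
  [forall l : 'I_k, x (n - k.-1%:Z + (k.-1 - j + l)%:Z)%R == tnth w l] <->
  occurs_at w x (n - j%:Z)%R.
Proof.
have := ltn_ord j => lt_jk.
split=> [/forallP all_l l | occ_j].
  by rewrite -(eqP (all_l l)); congr x; lia.
by apply/forallP => l; rewrite -occ_j; apply/eqP; congr x; lia.
Qed.

Variant occ_offset_spec w x (n : int) : option 'I_k -> Prop :=
  | OccAt (j : 'I_k) of occurs_at w x (n - j%:Z)%R : occ_offset_spec w x n (Some j)
  | OccNone of (forall i, covers k n i -> ~ occurs_at w x i) :
      occ_offset_spec w x n None.

Lemma occ_offsetP w x n :
  occ_offset_spec w x n (occ_offset w (fun p => x (n - k.-1%:Z + p%:Z)%R)).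
Proof.
rewrite /occ_offset; case: pickP => [j /occ_offset_occurs|no_j]; constructor=> //.
move=> i [le_in lt_ni] w_i.
have lt_dk : `|n - i|%N < k by lia.
have /negP[] := negbT (no_j (Ordinal lt_dk)); apply/occ_offset_occurs => /=.
by have -> : (n - `|n - i|%N%:Z = i)%R by lia.
Qed.

Lemma swap_map_swapped u v x :
  non_overlapping u v -> swapped u v x (swap_map u v x).
Proof.
move=> no_uv.
have uP : u \in [:: u; v] by rewrite !inE eqxx.
have vP : v \in [:: u; v] by rewrite !inE eqxx orbT.
have cov (i : int) (j : 'I_k) : covers k (i + j%:Z)%R i.
  by have := ltn_ord j; rewrite /covers; lia.
have cov' (n : int) (j : 'I_k) : covers k n (n - j%:Z)%R.
  by have := ltn_ord j; rewrite /covers; lia.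
have eq_off (i : int) (j j' : 'I_k) : i = (i + j%:Z - j'%:Z)%R -> j = j'.
  by move=> ?; apply: val_inj => /=; lia.
split=> [i u_i j|i v_i j|n uncov]; rewrite /swap_map /swap_rule.
- case: occ_offsetP => [j' u_j' | no_u]; last by case: (no_u i (cov i j)).
  have [_ /eq_off->//] := occurs_disjoint no_uv uP uP u_i u_j' (cov i j) (cov' _ _).
- case: occ_offsetP => [j' u_j' | _].
    by have [-> /eq_off->] := occurs_disjoint no_uv vP uP v_i u_j' (cov i j) (cov' _ _).
  case: occ_offsetP => [j' v_j' | no_v]; last by case: (no_v i (cov i j)).
  by have [_ /eq_off->] := occurs_disjoint no_uv vP vP v_i v_j' (cov i j) (cov' _ _).
- case: occ_offsetP => [j u_j | _].
    by have [le_n lt_n] := cov' n j; case: (uncov _ le_n lt_n).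
  case: occ_offsetP => [j v_j | _].
    by have [le_n lt_n] := cov' n j; case: (uncov _ le_n lt_n).
  by congr x; lia.
Qed.

Lemma swap_map_sliding_block_code u v X : sliding_block_code X (swap_map u v).
Proof.
exists k.-1, k.-1, (fun t => swap_rule u v (nth (thead t) t)) => x _ n.
set t := [tuple _ | _ < _].
have eq_t p : p < (k.-1 + k.-1).+1 ->
    x (n - k.-1%:Z + p%:Z)%R = nth (thead t) t p.
  by move=> lt_p; rewrite -(tnth_nth _ t (Ordinal lt_p)) tnth_mktuple.
rewrite /swap_map /swap_rule !(occ_offset_ext _ eq_t) eq_t //.
by rewrite ltnS leq_addr.
Qed.

(** By symmetry of the swap relation and uniqueness of the swapped sequence,
    the swap is its own inverse; this gives both injectivity and
    surjectivity. *)
Theorem swap_conjugacy_non_overlapping u v :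
  non_overlapping u v -> swap_conjugacy u v (swap_map u v).
Proof.
move=> no_uv; have sw x := swap_map_swapped x no_uv.
split; last by left=> x _; apply: sw.
split; first exact: swap_map_sliding_block_code.
split=> [x no_u i /(swapped_occurs no_uv (sw x)) /no_u //|x x' _ _ eq_sw|y no_v].
  have sw' := swapped_sym no_uv (sw x').
  by rewrite -eq_sw in sw'; apply: swapped_inj (swapped_sym no_uv (sw x)) sw'.
have sw_y := swapped_sym no_uv (sw y).
exists (swap_map u v y); last exact: swapped_inj (sw _) sw_y.
by move=> i u_i; case: sw_y => /(_ i u_i) /no_v.
Qed.

End Swap.

Lemma perm_swap_conjugacy (A : finType) (k : nat) (u : k.-tuple A) (s : {perm A}) :
  swap_conjugacy u (map_tuple s u) (fun x => s \o x).
Proof.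
have occ_s (r : {perm A}) (w : k.-tuple A) x i :
    occurs_at w x i -> occurs_at (map_tuple r w) (r \o x) i.
  by move=> w_i j; rewrite /= w_i tnth_map.
have sK (y : int -> A) : s \o (s^-1%g \o y) = y.
  by apply/funext => n /=; rewrite permKV.
split; last by right; exists s.
split.
  exists 0, 0, (fun t => s (thead t)) => x _ i /=.
  by congr (s _); rewrite /thead tnth_mktuple subr0 addr0.
split=> [x no_u i s_i|x x' _ _ eq_x|y no_su].
- apply: (no_u i) => j; apply: (@perm_inj _ s).
  by move: (s_i j); rewrite /= tnth_map.
- by apply/funext => n; apply: (@perm_inj _ s); have := congr1 (@^~ n) eq_x.
exists (s^-1%g \o y)%FUN => //= i u_i; apply: (no_su i).
by rewrite -(sK y); apply: occ_s.
Qed.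

(** * Binary words, blocks and the hub *)

Section BinaryWords.
Variable k : nat.
Hypothesis k_gt1 : 1 < k.
Implicit Types (u v w : k.-tuple bool).

Definition word (f : nat -> bool) : k.-tuple bool := [tuple f i | i < k].

Lemma nth_word f i : i < k -> nth false (word f) i = f i.
Proof. by move=> lt_ik; rewrite -(tnth_nth _ _ (Ordinal lt_ik)) tnth_mktuple. Qed.

Definition block (a : nat) := word (fun i => i < a).

Definition hub := word (fun i => (i == 0) || (i == 2)).

Lemma unborderedP w :
  reflect (forall i, 0 < i < k ->
             ~ (forall j, j < i -> nth false w j = nth false w (k - i + j)))
          (overlap w w == [set ord_max]%SET).
Proof.
apply: (iffP eqP) => [ov_w i /andP[i_gt0 lt_ik] per_i | unb_w].
  have: inord i \in overlap w w.
    by apply/(overlapP false); rewrite inordK // ltnW.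
  rewrite ov_w inE => /eqP /(congr1 val) /=.
  by rewrite inordK; lia.
apply/setP => i; rewrite [RHS]inE; apply/idP/eqP => [/(overlapP false)[i_gt0 per_i]|->].
  apply: val_inj => /=; have le_ik := ltn_ord i.
  case: (ltnP i k) => [lt_ik | ?]; last by lia.
  by case: (unb_w i); rewrite ?i_gt0.
by apply/(overlapP false); rewrite /= subnn; split=> //; lia.
Qed.

(** For a word starting with 1, a second 1 rules out [1 0^(k-1)] and a 0 before
    the last letter rules out [1^(k-1) 0]. *)
Lemma mem_C w i j :
    nth false w 0 -> 0 < i -> nth false w i -> j < k.-1 -> ~~ nth false w j ->
    overlap w w == [set ord_max]%SET ->
  w \in C k.
Proof.
move=> w0 i_gt0 w_i lt_jk w_j ov_w; rewrite inE ov_w andbT !inE !negb_or.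
apply/and4P; split; apply/eqP => def_w; move: w0 w_i w_j; rewrite def_w.
- by case: i i_gt0 => // i _ _ /=; rewrite nth_nseq if_same.
- by [].
- by rewrite !nth_rcons size_nseq lt_jk !nth_nseq lt_jk.
- by rewrite nth_rcons size_nseq nth_nseq; case: (k) k_gt1 => [|[]].
Qed.

Lemma C_unbordered w : w \in C k ->
  forall i, 0 < i < k ->
  ~ (forall j, j < i -> nth false w j = nth false w (k - i + j)).
Proof. by rewrite inE => /andP[_ /unborderedP]. Qed.

(** Otherwise the first and last letters would form an overlap of length 1. *)
Lemma C_last w : w \in C k -> nth false w 0 -> ~~ nth false w k.-1.
Proof.
move=> /C_unbordered /(_ 1 k_gt1) unb w0; apply/negP => w_last; apply: unb.
by case=> // _; rewrite w0 addn0 subn1 w_last.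
Qed.

Lemma flipK : involutive (@flip k).
Proof. by move=> w; apply: val_inj; rewrite /= mapK //; apply: negbK. Qed.

Lemma overlap_flip u v : overlap (flip u) (flip v) = overlap u v.
Proof.
apply/setP => i; rewrite !inE /= -map_take -map_drop.
by rewrite (inj_eq (inj_map negb_inj)).
Qed.

Lemma flip_in_C w : (flip w \in C k) = (w \in C k).
Proof.
have negs s t : (map negb s == map negb t) = (s == t :> seq bool).
  exact: (inj_eq (inj_map negb_inj)).
rewrite !inE overlap_flip; congr (~~ _ && _) => /=.
rewrite -(negs w (true :: _)) -(negs w (false :: _)) -!(negs w (rcons _ _)).
rewrite !map_rcons /= !map_nseq /=.
(* Flipping permutes the four excluded words. *)
by do ![case: (_ == _)].
Qed.

Lemma block_in_C a : 1 < a < k.-1 -> block a \in C k.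
Proof.
move=> /andP[a_gt1 lt_ak].
apply: (@mem_C _ 1 a) => //; rewrite ?nth_word ?ltnn //; try lia.
apply/unborderedP => i /andP[i_gt0 lt_ik] per_i.
have {}per_i m : m < i -> (m < a) = (k - i + m < a).
  by move=> lt_mi; have := per_i m lt_mi; rewrite !nth_word //; lia.
have := per_i 0 i_gt0; have := per_i i.-1; have := per_i a.-1; lia.
Qed.

Lemma hub_in_C : 4 < k -> hub \in C k.
Proof.
move=> k_gt4.
apply: (@mem_C _ 2 1) => //; rewrite ?nth_word //; try lia.
apply/unborderedP => i /andP[i_gt0 lt_ik] per_i.
have {}per_i m : m < i ->
    (m == 0) || (m == 2) = (k - i + m == 0) || (k - i + m == 2).
  by move=> lt_mi; have := per_i m lt_mi; rewrite !nth_word //; lia.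
have := per_i 0 i_gt0; have := per_i 2; lia.
Qed.

(** A suffix of [w] that is a prefix of the block must contain a 0, since [w]
    ends with 0, so it is [1^a 0^s]; its [a] ones are the positions
    [e-a+1 .. e], among which is [c], where [w] has a 0. *)
Lemma overlap_block_suffix w a c e :
    c < e -> e < c + a -> e < k.-1 -> a < k ->
    ~~ nth false w c -> nth false w e ->
    (forall j, e < j -> ~~ nth false w j) ->
  overlap w (block a) = finset.set0.
Proof.
move=> lt_ce lt_ea lt_ek lt_ak w_c w_e w_tail.
apply: (overlap0P (x0 := false)) => i /andP[i_gt0 le_ik] ov_i.
have {}ov_i m : k - i <= m < k -> nth false w m = (m - (k - i) < a).
  move=> /andP[le_m lt_m]; rewrite -(nth_word (fun j => j < a)); last by lia.
  by rewrite ov_i ?subnKC //; lia.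
have lt_ai : a < i.
  have := ov_i k.-1; rewrite (negbTE (w_tail _ lt_ek)); lia.
have le_e : k - i + a.-1 <= e.
  rewrite leqNgt; apply/negP => /w_tail; rewrite ov_i; lia.
(* The ones of the suffix end exactly at the last 1 of [w]. *)
have def_e : e = k - i + a.-1 by have := ov_i e; rewrite w_e; lia.
have := ov_i c; rewrite (negbTE w_c); lia.
Qed.

(** A prefix of [w] that is a suffix of the block must contain a 1, so it is
    [1^d 0^(k-a)]; its zeros reach position [g], where [w] has a 1. *)
Lemma overlap_block_prefix w a d g :
    0 < d -> d < g -> g + a < k + d -> a < k ->
    (forall j, j < d -> nth false w j) -> ~~ nth false w d -> nth false w g ->
  overlap (block a) w = finset.set0.
Proof.
move=> d_gt0 lt_dg lt_g lt_ak w_head w_d w_g.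
apply: (overlap0P (x0 := false)) => i /andP[i_gt0 le_ik] ov_i.
have {}ov_i m : m < i -> nth false w m = (k - i + m < a).
  by move=> lt_mi; rewrite ov_i // nth_word //; lia.
have lt_a : k - i < a by have := ov_i 0 i_gt0; rewrite w_head // addn0; lia.
have le_d : d <= i - (k - a).
  rewrite leqNgt; apply/negP => /w_head; rewrite ov_i; lia.
(* The zeros of the prefix start exactly at the first 0 of [w]. *)
have def_d : d = i - (k - a).
  by have := ov_i d; rewrite (negbTE w_d); lia.
have := ov_i g; rewrite w_g; lia.
Qed.

(** * Paths in the graph of elementary steps *)

Definition edge u v :=
  [&& u \in C k, v \in C k &
     (v == flip u) ||
     (overlap u v == finset.set0) && (overlap v u == finset.set0)].

Lemma edge_sym : symmetric edge.
Proof.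
move=> u v; rewrite /edge andbCA [v == _]eq_sym (can2_eq flipK flipK).
by rewrite [(overlap u v == _) && _]andbC.
Qed.

Lemma edge_flip u v : edge (flip u) (flip v) = edge u v.
Proof. by rewrite /edge !flip_in_C !overlap_flip (inj_eq (inv_inj flipK)). Qed.

Definition within n u v :=
  exists p, [/\ path edge u p, last u p = v & size p <= n].

Lemma within0 n u : within n u u.
Proof. by exists [::]. Qed.

Lemma within_edge u v : edge u v -> within 1 u v.
Proof. by move=> uv; exists [:: v]; rewrite /= uv. Qed.

Lemma within_trans m n u v w :
  within m u v -> within n v w -> within (m + n) u w.
Proof.
case=> p [path_p last_p le_p] [q [path_q last_q le_q]].
exists (p ++ q); rewrite cat_path last_cat size_cat last_p path_p.
by split=> //; apply: leq_add.
Qed.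

Lemma within_sym n u v : within n u v -> within n v u.
Proof.
case=> p [path_p <- le_p]; exists (rev (belast u p)); split.
- by rewrite rev_path (eq_path (e' := edge)) // => x y; rewrite edge_sym.
- by case: p {path_p le_p} => //= x p; rewrite rev_cons last_rcons.
- by rewrite size_rev size_belast.
Qed.

Lemma within_flip n u v : within n u v -> within n (flip u) (flip v).
Proof.
case=> p [path_p <- le_p]; exists (map (@flip k) p); split.
- by rewrite path_map (eq_path (e' := edge)) // => x y /=; rewrite edge_flip.
- by rewrite last_map.
- by rewrite size_map.
Qed.

(** The hub has its only 01 at positions 1 and 2, which are also its first 0
    and its last 1. *)
Lemma edge_block_hub a : 4 < k -> 1 < a < k.-1 -> edge (block a) hub.
Proof.
move=> k_gt4 a_bnd; rewrite /edge block_in_C // hub_in_C //=; apply/orP; right.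
have hubE i : nth false hub i = (i < k) && ((i == 0) || (i == 2)).
  case: (ltnP i k) => [/nth_word-> // | le_ki].
  by rewrite nth_default ?size_tuple.
rewrite (@overlap_block_prefix _ _ 1 2) ?(@overlap_block_suffix _ _ 1 2) ?eqxx //;
  rewrite ?hubE; try lia; move=> j lt_j; rewrite hubE; lia.
Qed.

(** If the last 1 (at [e]) precedes the first 0 (at [d]), then [u] is a block.
    Otherwise take 01 at [t], [t+1] with [d <= t < e] and [a := e-t+1]: the 0 at
    [t] bounds the last run of ones by [e-t < a], and the 1 at [t+1] bounds the
    first run of zeros by [t+1-d < k-a]. *)
Lemma block_or_edge_block u : u \in C k -> nth false u 0 ->
  exists2 a, 1 < a < k.-1 & u = block a \/ edge u (block a).
Proof.
move=> uC u0; have u_last := C_last uC u0.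
have ex_d : exists d, ~~ nth false u d by exists k.-1.
case: (ex_minnP ex_d) => d u_d min_d.
have u_head j : j < d -> nth false u j.
  by move=> lt_jd; apply: contraLR lt_jd => /min_d; rewrite -leqNgt.
have u_lt j : nth false u j -> j < k.-1.
  move=> u_j; have: j < k.
    by case: ltnP u_j => // le_kj; rewrite nth_default ?size_tuple.
  by move: u_j u_last; case: (eqVneq j k.-1) => [->|]; [move->|lia].
have ex_e : exists e, nth false u e by exists 0.
have le_e j : nth false u j -> j <= k.-1 by move/u_lt/ltnW.
case: (ex_maxnP ex_e le_e) => e u_e max_e.
have u_tail j : e < j -> ~~ nth false u j.
  by move=> lt_ej; apply/negP => /max_e; rewrite leqNgt lt_ej.
have d_gt0 : 0 < d by case: d u_d {min_d u_head} => //; rewrite u0.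
have lt_ek := u_lt e u_e.
have ne_de : d != e by apply: contraNneq u_d => ->.
case: (ltnP e d) => [lt_ed | le_de].
  have def_d : d = e.+1 by apply/eqP; rewrite eqn_leq lt_ed min_d // u_tail.
  have def_u : u = block d.
    apply/val_inj/(@eq_from_nth _ false); first by rewrite !size_tuple.
    move=> j; rewrite size_tuple => lt_jk; rewrite nth_word //.
    by case: ltnP => [/u_head // | le_dj]; apply/negbTE/u_tail; lia.
  exists d; last by left.
  move: uC; rewrite inE => /andP[]; rewrite !inE !negb_or.
  case/and4P => /eqP not1 _ /eqP not2 _ _.
  have d_ne1 : d <> 1.
    move=> d1; apply: not1; apply: (@eq_from_nth _ false).
      by rewrite size_tuple /= size_nseq; lia.
    move=> j; rewrite size_tuple def_u d1 => lt_jk; rewrite nth_word //.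
    by case: j lt_jk => //= j _; rewrite nth_nseq if_same.
  have d_neK : d <> k.-1.
    move=> dK; apply: not2; apply: (@eq_from_nth _ false).
      by rewrite size_tuple size_rcons size_nseq; lia.
    move=> j; rewrite size_tuple def_u dK => lt_jk; rewrite nth_word //.
    rewrite nth_rcons size_nseq nth_nseq; case: ltnP => //; by rewrite if_same.
  by move: lt_ek; lia.
have [t [/andP[le_dt lt_te] u_t u_t1]] :
    exists t, [/\ d <= t < e, ~~ nth false u t & nth false u t.+1].
  (* The first 1 after position [d] is preceded by a 0. *)
  pose P t := (d <= t) && nth false u t.
  have exP : exists t, P t by exists e; rewrite /P le_de.
  case: (ex_minnP exP) => g /andP[le_dg u_g] min_g.
  have lt_dg : d < g by rewrite ltn_neqAle le_dg andbT; apply: contraNneq u_d => ->.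
  have g_gt0 := leq_ltn_trans (leq0n d) lt_dg.
  exists g.-1; rewrite (prednK g_gt0) u_g; split=> //.
    by have := max_e g u_g; lia.
  apply/negP => u_g'; have := min_g g.-1; rewrite /P u_g'; lia.
exists (e - t).+1; first by lia.
right; rewrite /edge uC block_in_C /=; last by lia.
apply/orP; right.
rewrite (@overlap_block_suffix _ _ t e) //; try lia.
rewrite (@overlap_block_prefix _ _ d t.+1) ?eqxx //; lia.
Qed.

Lemma within_hub u : 4 < k -> u \in C k -> nth false u 0 -> within 2 u hub.
Proof.
move=> k_gt4 uC u0; have [a a_bnd u_a] := block_or_edge_block uC u0.
have hub_a := within_edge (edge_block_hub k_gt4 a_bnd).
have {u_a}u_a : within 1 u (block a).
  by case: u_a => [->|/within_edge //]; apply: within0.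
exact: within_trans u_a hub_a.
Qed.

End BinaryWords.

(** * Short words and the diameter bound *)

Lemma C4_head1 (u : 4.-tuple bool) : u \in C 4 -> nth false u 0 ->
  u = [tuple true; true; false; false].
Proof.
move=> uC u0; have u_last := C_last (isT : 1 < 4) uC u0; apply: val_inj => /=.
have unb2 := C_unbordered (isT : 1 < 4) uC (isT : 0 < 2 < 4).
move: uC; rewrite inE => /andP[]; rewrite !inE => not_excl _.
case: u u0 u_last unb2 not_excl => -[|[] [|b [|c [|[] []]]]] //= _ _ _.
by case: b c => -[] // unb2 _; case: unb2 => -[|[]].
Qed.

Lemma within_head1 k (u v : k.-tuple bool) : 1 < k ->
  u \in C k -> v \in C k -> nth false u 0 -> nth false v 0 -> within 4 u v.
Proof.
move=> k_gt1 uC vC u0 v0; case: (ltnP 4 k) => [k_gt4 | k_le4].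
  apply: (within_trans (within_hub k_gt1 k_gt4 uC u0)).
  exact/within_sym/(within_hub k_gt1 k_gt4 vC v0).
have [a a_bnd _] := block_or_edge_block k_gt1 uC u0.
(* The range of [a] is empty for [k < 4]. *)
have k4 : k = 4 by lia.
by subst k; rewrite (C4_head1 uC u0) (C4_head1 vC v0); apply: within0.
Qed.

Lemma C_gt1 k (u : k.-tuple bool) : 0 < k -> u \in C k -> 1 < k.
Proof.
case: k u => [|[|k]] // [[|b []]] //= sz _.
by rewrite !inE; case: b sz.
Qed.

(** Flipping both words if necessary, [u] starts with 1; then either [v] or
    [flip v] does, and in the latter case one final flip is added. *)
Lemma C_within5 k (u v : k.-tuple bool) : 0 < k ->
  u \in C k -> v \in C k -> within 5 u v.
Proof.
move=> k_gt0 uC vC; have k_gt1 := C_gt1 k_gt0 uC.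
have nth_flip (w : k.-tuple bool) : nth false (flip w) 0 = ~~ nth false w 0.
  by rewrite (nth_map false) // size_tuple.
wlog u0 : u v uC vC / nth false u 0.
  move=> IH; case u0: (nth false u 0); first exact: IH.
  rewrite -(flipK u) -(flipK v); apply: within_flip; apply: IH.
  - by rewrite flip_in_C.
  - by rewrite flip_in_C.
  - by rewrite nth_flip u0.
case v0: (nth false v 0).
  have [p [? ? le_p]] := within_head1 k_gt1 uC vC u0 v0.
  by exists p; split=> //; apply: leqW.
have vC' : flip v \in C k by rewrite flip_in_C.
apply: (@within_trans _ 4 1 _ (flip v)).
  by apply: within_head1; rewrite ?nth_flip ?v0.
by apply: within_edge; rewrite /edge vC' vC flipK eqxx.
Qed.

Lemma edge_swap_conjugacy k (u v : k.-tuple bool) : 0 < k -> edge u v ->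
  exists phi, swap_conjugacy u v phi.
Proof.
move=> k_gt0 /and3P[uC vC /orP[/eqP->|/andP[/eqP ov_uv /eqP ov_vu]]].
  exists (fun x => perm negb_inj \o x).
  have -> : flip u = map_tuple (perm negb_inj) u.
    by apply: val_inj; apply: eq_map => b /=; rewrite permE.
  exact: perm_swap_conjugacy.
exists (swap_map u v); apply: swap_conjugacy_non_overlapping => // a b.
move: uC vC; rewrite !inE => /andP[_ /eqP ov_u] /andP[_ /eqP ov_v].
move=> /orP[] /eqP-> /orP[] /eqP-> i;
  by rewrite ?ov_u ?ov_v ?ov_uv ?ov_vu inE // => /eqP.
Qed.

Theorem theorem4p3 (k : nat) (hk : 0 < k) (u v : k.-tuple bool)
    (hu : u \in C k) (hv : v \in C k) (huv : u <> v) :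
  (exists (N : nat) (w : nat -> k.-tuple bool),
     [/\ 1 <= N <= 6, w 1 = u, w N = v,
         forall i : nat, 1 <= i <= N -> w i \in C k
       & forall i : nat, 1 <= i < N ->
           w i.+1 = flip (w i) \/
           (overlap (w i) (w i.+1) = finset.set0 /\
            overlap (w i.+1) (w i) = finset.set0)]) /\
  (exists (N : nat) (w : nat -> k.-tuple bool),
     N <= 6 /\ swap_chain u v N w).
Proof.
have [p [path_p last_p le_p]] := C_within5 hk hu hv.
pose w i := nth u (u :: p) i.-1.
have w_last : w (size p).+1 = v by rewrite /w -last_p -(last_nth u u p).
have w_edge i : 1 <= i < (size p).+1 -> edge (w i) (w i.+1).
  by case: i => // i /= lt_ip; apply: (pathP u path_p).
split; exists (size p).+1, w.
  split=> // i.
    case: i => [|[|i]] //= lt_ip.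
    by case/and3P: (w_edge i.+1 lt_ip).
  by move=> /w_edge/and3P[_ _ /orP[/eqP | /andP[/eqP ? /eqP ?]]]; [left | right].
split=> //; split=> // i /w_edge.
exact: edge_swap_conjugacy.
Qed.
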